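(* Let $k$ and $d\ge 2$ be positive integers, and let $n=4k+1$. Let $A\in\mathbb{R}^{(d-1)n\times d}$ be the matrix obtained as the vertical stack of the blocks $A_1,\alpha A_2,\dots,\alpha^{d-2}A_{d-1}$ defined in the context. Then the dual $d$-zonotope $Z^*=Z_A^*=\{x\in\mathbb{R}^d:\sum_{j}|a_jx|\le 1\}$, where $a_j$ runs over the rows of $A$, has $(d-1)n$ zones, and its projection to the first two coordinates $(x_0,x_1)$ has (at least) $2n^{d-1}+2n^{d-2}$ vertices.
   Context: Coordinates of $\mathbb{R}^d$ and columns of matrices are indexed by $0,1,\dots,d-1$. Put $n=4k+1$, $\alpha=\frac1{n+1}$, $\mathbf b=(k,k-1,\dots,-k)^T\in\mathbb{R}^{2k+1}$ and $\mathbf b'=(-k+\tfrac12,-k+\tfrac32,\dots,k-\tfrac12)^T\in\mathbb{R}^{2k}$. For $1\le i\le d-1$ let $A_i\in\mathbb{R}^{n\times d}$ be the matrix whose $0$-th column is $\alpha^{i-1}\binom{\mathbf b}{\mathbf b'}$, whose $i$-th column is $\binom{\mathbf 1}{-\mathbf 1}$ (the first $2k+1$ entries are $1$, the last $2k$ entries are $-1$), whose $(i+1)$-st column is the all-ones vector (this column is omitted if $i=d-1$), and whose other entries are all $0$. The matrix $A$ is obtained by stacking $A_1,\alpha A_2,\alpha^2A_3,\dots,\alpha^{d-2}A_{d-1}$ on top of each other. A $d$-dimensional dual zonotope (dual $d$-zonotope) with $m$ zones is a polytope $\{x\in\mathbb{R}^d:\sum_{j=1}^m|a_jx|\le1\}$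 with row vectors $a_1,\dots,a_m$ that span $(\mathbb{R}^d)^*$, all nonzero and no one a scalar multiple of another.
   Formalization: The bound of 2n^{d-1}+2n^{d-2} vertices is stated only for d ≥ 3; for d = 2 it is false, since a planar dual zonotope with n zones has at most 2n < 2n+2 vertices, and the bound 2n is stated there instead. *)

(* Defs.v *)
From HB Require Import structures.
From mathcomp Require Import all_boot all_order all_algebra.
From mathcomp Require Import boolp classical_sets functions cardinality reals.
Set Implicit Arguments.
Unset Strict Implicit.
Unset Printing Implicit Defensive.
Import Order.TTheory GRing.Theory Num.Theory.
Local Open Scope ring_scope.
Local Open Scope classical_set_scope.

(* Points are column vectors and linear functionals are row vectors. *)

Definition polytope (R : realType) (d : nat) (P : set 'cV[R]_d) : Prop :=
  (exists (m : nat) (C : 'M[R]_(m, d)) (c : 'cV[R]_m),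
     P = [set x | forall j, (C *m x) j 0 <= c j 0]) /\
  (exists M : R, forall x, P x -> forall i, `|x i 0| <= M).

(* The 0-dimensional faces of P, a face being the set of maximizers over P of
   a linear functional. *)
Definition vertices (R : realType) (d : nat) (P : set 'cV[R]_d) : set 'cV[R]_d :=
  [set v | P v /\ exists c : 'rV[R]_d,
     forall x, P x -> x <> v -> (c *m x) 0 0 < (c *m v) 0 0].

Definition dual_zonotope (R : realType) (m d : nat) (A : 'M[R]_(m, d)) :
    set 'cV[R]_d :=
  [set x | \sum_(j < m) `|(row j A *m x) 0 0| <= 1].

Definition is_dual_zonotope (R : realType) (d m : nat) (Z : set 'cV[R]_d) : Prop :=
  polytope Z /\
  exists A : 'M[R]_(m, d),
    [/\ Z = dual_zonotope A,
        row_full A,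
        forall j, row j A != 0
      & forall j l, j != l -> forall t : R, row j A != t *: row l A].

(* [col0 k] lists the entries of the vector b followed by those of b'. *)
Definition col0 (R : realType) (k : nat) (j : nat) : R :=
  if (j < 2 * k + 1)%N then k%:R - j%:R
  else - k%:R + 2^-1 + (j - (2 * k + 1))%:R.

Definition sgn_col (R : realType) (k : nat) (j : nat) : R :=
  if (j < 2 * k + 1)%N then 1 else -1.

Definition alpha (R : realType) (k : nat) : R := ((4 * k + 1) + 1)%:R^-1.

(* A_i, for 1 <= i <= d - 1. When i = d - 1 no column has index i + 1. *)
Definition block (R : realType) (k d i : nat) : 'M[R]_(4 * k + 1, d) :=
  \matrix_(j, c)
    if c == 0 :> nat then alpha R k ^+ i.-1 * col0 R k j
    else if c == i :> nat then sgn_col R k j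
    else if c == i.+1 :> nat then 1
    else 0.

Fact sum_rows (m n : nat) : (\sum_(i < m) n)%N = (m * n)%N.
Proof. by rewrite sum_nat_const card_ord. Qed.

(* The row index of \mxcol ranges over a sum of block heights. *)
Definition stackA (R : realType) (k d : nat) :
    'M[R]_(d.-1 * (4 * k + 1), d) :=
  castmx (sum_rows d.-1 (4 * k + 1), erefl d)
    (\mxcol_(i < d.-1) (alpha R k ^+ i *: block R k d i.+1)).

Definition proj2 (R : realType) (d : nat) (hd : (2 <= d)%N) (x : 'cV[R]_d) :
    'cV[R]_2 :=
  \col_(i < 2) x (widen_ord hd i) 0.

(* Main.v *)
Require Import Defs.
From HB Require Import structures.
From mathcomp Require Import all_boot all_order all_algebra.
From mathcomp Require Import boolp classical_sets functions cardinality reals.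
From mathcomp Require Import ring lra zify.
Local Open Scope ring_scope.
Local Open Scope classical_set_scope.
Local Open Scope card_scope.
Set Implicit Arguments.
Unset Strict Implicit.
Unset Printing Implicit Defensive.
Import Order.TTheory GRing.Theory Num.Theory.

(* The projected polygon is counted through its edges. A linear form supporting
   it along an edge is a combination [\sum_t mu_t L_t] of the rows in which the
   coordinates of index >= 2 cancel, where [mu_t] is the sign of [L_t x] for a
   point [x] above the edge and [|mu_t| < 1] for the rows vanishing at [x].
   Leaving [x] inside the common kernel of those rows, until the first further
   row vanishes, gives a vertex at the counterclockwise end of the edge, and an
   edge is determined by that end.

   For [d = N + 2] the edges come from a sign, one row [J i] in each block
   [i < N], and a level for the last coordinate, chosen in one of the [n + 1]
   gaps cut out by the [n] rows of the last block. The other coordinates are then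
   forced by the rows [J i] and stay so small that, within each block [i < N],
   the zeros of the rows with sign +1 and of those with sign -1 alternate. Hence
   the signs of the remaining rows of the block sum to 0, and the multiplier of
   [J i] only has to compensate block [i + 1], weighted by [alpha < 1 / n]. This
   yields [2 n^N (n + 1)] edges. *)

(** * Edges and vertices of a projected polar *)

Section LinearForms.
Variables (R : realType) (d : nat).
Implicit Types (r s : 'rV[R]_d) (x y : 'cV[R]_d).

Definition ev r x : R := (r *m x) 0 0.

Lemma evDl r s x : ev (r + s) x = ev r x + ev s x.
Proof. by rewrite /ev mulmxDl mxE. Qed.

Lemma evDr r x y : ev r (x + y) = ev r x + ev r y.
Proof. by rewrite /ev mulmxDr mxE. Qed.

Lemma evZr a r x : ev r (a *: x) = a * ev r x.
Proof. by rewrite /ev -scalemxAr mxE. Qed.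

Lemma ev_sum (T : finType) (a : T -> R) (L : T -> 'rV[R]_d) x :
  ev (\sum_t a t *: L t) x = \sum_t a t * ev (L t) x.
Proof.
rewrite /ev mulmx_suml summxE; apply: eq_bigr => t _.
by rewrite -scalemxAl mxE.
Qed.

Lemma ev_delta c x : ev (delta_mx 0 c) x = x c 0.
Proof. by rewrite /ev -rowE mxE. Qed.

End LinearForms.

Section Plane.
Variable R : realType.
Implicit Types u v w : 'cV[R]_2.

Definition det2 u v : R := u 0 0 * v 1 0 - u 1 0 * v 0 0.

Lemma det2Zr a u v : det2 u (a *: v) = a * det2 u v.
Proof. by rewrite /det2 !mxE; ring. Qed.

Lemma det2_basis u v w : det2 u v != 0 -> exists a b, w = a *: u + b *: v.
Proof.
move=> uv0; exists (det2 w v / det2 u v), (det2 u w / det2 u v).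
apply/matrixP => i j; rewrite (ord1 j) !mxE {j}.
have -> : i = if val i == 0%N then 0 else 1 by case: i => -[|[|//]] ?; apply/val_inj.
by move: uv0; rewrite /det2; case: ifP => _ ?; field.
Qed.

End Plane.

Section ProjectedPolar.
Variables (R : realType) (N : nat) (hd : (2 <= N.+2)%N).
Variables (T : finType) (L : T -> 'rV[R]_N.+2).
Hypothesis ev_separates : forall x, (forall t, ev (L t) x = 0) -> x = 0.
Implicit Types x y z w : 'cV[R]_N.+2.

Local Notation pi := (proj2 hd).
Local Notation Z := [set x | \sum_t `|ev (L t) x| <= 1].

(** These are exactly the forms that factor through [pi]. *)
Definition planar (r : 'rV[R]_N.+2) : Prop :=
  forall c : 'I_N.+2, (1 < c)%N -> r 0 c = 0.

Lemma planarD r s : planar r -> planar s -> planar (r + s).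
Proof. by move=> r0 s0 c c1; rewrite mxE r0 // s0 // addr0. Qed.

Lemma planarZ a r : planar r -> planar (a *: r).
Proof. by move=> r0 c c1; rewrite mxE r0 // mulr0. Qed.

Definition plane_form (r : 'rV[R]_N.+2) : 'rV[R]_2 :=
  \row_i r 0 (widen_ord hd i).

Lemma ev_plane_form r x : planar r -> ev (plane_form r) (pi x) = ev r x.
Proof.
move=> r0; rewrite /ev !mxE !big_ord_recl big_ord0 !mxE [X in _ = _ + (_ + X)]big1.
  have -> : widen_ord hd ord0 = ord0 by apply: val_inj.
  have -> : widen_ord hd (lift ord0 ord0) = lift ord0 ord0 by apply: val_inj.
  by congr (_ * _ + (_ * _ + _)).
by move=> i _; rewrite r0 ?mul0r.
Qed.

Lemma projD x y : pi (x + y) = pi x + pi y.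
Proof. by apply/matrixP => i j; rewrite !mxE. Qed.

Lemma projZ a x : pi (a *: x) = a *: pi x.
Proof. by apply/matrixP => i j; rewrite !mxE. Qed.

(** The combination is a planar subgradient at [x] of the norm whose unit ball is [Z]; the strict
    bound puts it in the relative interior of the subdifferential. *)
Definition edge_multiplier x (mu : T -> R) : Prop :=
  [/\ forall t, ev (L t) x != 0 -> mu t = Num.sg (ev (L t) x),
      forall t, ev (L t) x = 0 -> `|mu t| < 1
    & planar (\sum_t mu t *: L t)].

(** By [ep_solve], every form is planar modulo the rows vanishing at [x], so [pi] is injective on
    their common kernel; [ep_turn] provides a second direction, so this kernel is a plane. *)
Record edge_point x : Prop := EdgePoint {
  ep_solve : forall r, exists delta : T -> R,
    (forall t, ev (L t) x != 0 -> delta t = 0) /\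
    planar (r + \sum_t delta t *: L t);
  ep_mult : exists mu, edge_multiplier x mu;
  ep_turn : exists y, (forall t, ev (L t) x = 0 -> ev (L t) y = 0) /\
    0 < det2 (pi x) (pi y) }.

Lemma edge_pointN x : edge_point x -> edge_point (- x).
Proof.
have evN t y : ev (L t) (- y) = - ev (L t) y by rewrite -scaleN1r evZr mulN1r.
move=> [solve [mu [mu1 mu2 mu3]] [y [y1 y2]]]; split.
- move=> r; have [delta [d1 d2]] := solve r; exists delta; split=> // t.
  by rewrite evN oppr_eq0 => /d1.
- exists (fun t => - mu t); split.
  + by move=> t; rewrite evN oppr_eq0 sgrN => /mu1 ->.
  + by move=> t /eqP; rewrite evN oppr_eq0 normrN => /eqP /mu2.
  + move=> c c1; under eq_bigr do rewrite scaleNr.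
    by rewrite sumrN mxE mu3 ?oppr0.
- exists (- y); split; last by move: y2; rewrite /det2 !mxE; lra.
  by move=> t /eqP; rewrite !evN oppr_eq0 => /eqP /y1 ->; rewrite oppr0.
Qed.

(** [ep_solve], applied to a coordinate form, yields a planar form with the same value at [y], and
    that value depends on [pi y] only. *)
Lemma edge_tight_eq0 x y : edge_point x ->
  (forall t, ev (L t) x = 0 -> ev (L t) y = 0) -> pi y = 0 -> y = 0.
Proof.
move=> [solve _ _] ty py; apply/matrixP => c j; rewrite (ord1 j) {j} !mxE.
have [delta [d1 d2]] := solve (delta_mx 0 c).
have := ev_plane_form y d2; rewrite py /ev mulmx0 mxE -/(ev _ _).
rewrite evDl ev_delta ev_sum big1 ?addr0 // => t _.
by have [/ty ->|/d1 ->] := eqVneq (ev (L t) x) 0; rewrite ?mulr0 ?mul0r.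
Qed.

Lemma edge_tight_span x y z : edge_point x ->
  (forall t, ev (L t) x = 0 -> ev (L t) y = 0) ->
  (forall t, ev (L t) x = 0 -> ev (L t) z = 0) ->
  det2 (pi x) (pi y) != 0 -> exists a b, z = a *: x + b *: y.
Proof.
move=> ex ty tz xy0; have [a [b zab]] := det2_basis (pi z) xy0.
exists a, b; apply/subr0_eq/(edge_tight_eq0 ex) => [t t0|].
  by rewrite -scaleN1r !(evDr, evZr) t0 ty // tz // !(mulr0, addr0).
by rewrite -scaleN1r !(projD, projZ) zab scaleN1r subrr.
Qed.

Lemma ev_le_norm1 mu x : (forall t, `|mu t| <= 1) ->
  ev (\sum_t mu t *: L t) x <= \sum_t `|ev (L t) x|.
Proof.
move=> mu1; rewrite ev_sum; apply: ler_sum => t _.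
by rewrite (le_trans (ler_norm _)) // normrM ler_piMl.
Qed.

Lemma ev_eq_norm1 mu x : (forall t, `|mu t| <= 1) ->
  \sum_t `|ev (L t) x| <= ev (\sum_t mu t *: L t) x ->
  forall t, mu t * ev (L t) x = `|ev (L t) x|.
Proof.
move=> mu1; rewrite ev_sum => le_x t; apply/eqP; rewrite eq_sym -subr_eq0.
have ge0 s : true -> 0 <= `|ev (L s) x| - mu s * ev (L s) x.
  by move=> _; rewrite subr_ge0 (le_trans (ler_norm _)) // normrM ler_piMl.
apply/eqP; apply: (psumr_eq0P ge0) => //.
by apply/eqP; rewrite eq_le sumr_ge0 // andbT sumrB subr_le0.
Qed.

Lemma mult_tight (m a : R) : `|m| < 1 -> m * a = `|a| -> a = 0.
Proof.
move=> m1 ma; apply/eqP/negPn/negP => a0.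
have : `|m * a| < `|a| by rewrite normrM gtr_pMl // normr_gt0.
by rewrite ma normr_id ltxx.
Qed.

(** The planar form is at most 1 on [Z]. A point of [Z] with value 1 is an equality case row by row,
    so the rows with [|mu t| < 1] vanish there and it is a multiple of [w]; the value 1 makes the
    factor 1. *)
Lemma vertex_criterion mu w : (forall t, `|mu t| <= 1) ->
  planar (\sum_t mu t *: L t) ->
  \sum_t `|ev (L t) w| = 1 -> (forall t, mu t * ev (L t) w = `|ev (L t) w|) ->
  (forall y, (forall t, `|mu t| < 1 -> ev (L t) y = 0) -> exists b, y = b *: w) ->
  vertices (pi @` Z) (pi w).
Proof.
move=> mu1 mu_pl w1 mu_w w_line; split; first by exists w; rewrite //= w1.
have mw : ev (\sum_t mu t *: L t) w = 1.
  by rewrite ev_sum -w1; apply: eq_bigr.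
exists (plane_form (\sum_t mu t *: L t)) => _ [y /= yZ <-] yw.
rewrite -!/(ev _ _) !ev_plane_form // mw.
have := le_trans (ev_le_norm1 y mu1) yZ.
rewrite le_eqVlt => /orP[/eqP my|//]; case: yw.
have mu_y := ev_eq_norm1 (x := y) mu1; rewrite my in mu_y.
have [b yb] : exists b, y = b *: w.
  by apply: w_line => t mut; apply: mult_tight mut (mu_y yZ t).
by move: my; rewrite yb evZr mw mulr1 => ->; rewrite scale1r.
Qed.

Lemma small_perturbation (mu delta : T -> R) : exists e : R,
  0 < e < 1 /\ forall t, `|mu t| < 1 -> `|mu t + e * delta t| < 1.
Proof.
(* A product of slacks in (0, 1] lies below each of them; the summand 2 in [D] keeps [p / D] below
   1. *)
pose p := \prod_(t | `|mu t| < 1) (1 - `|mu t|).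
pose D := 2 + \sum_t `|delta t|.
have D_ge2 : 2 <= D by rewrite lerDl sumr_ge0.
have D_gt0 : 0 < D by rewrite (lt_le_trans _ D_ge2).
have p_gt0 : 0 < p by apply: prodr_gt0 => t; rewrite subr_gt0.
have p_le t : `|mu t| < 1 -> p <= 1 - `|mu t|.
  move=> mut; rewrite /p (bigD1 t) //= ler_piMr //.
    by rewrite subr_ge0 ltW.
  apply: Num.Theory.prodr_ile1 => s /andP[mus _]; rewrite subr_ge0 (ltW mus) /=.
  by rewrite lerBlDr lerDl.
have p_le1 : p <= 1.
  apply: Num.Theory.prodr_ile1 => s mus; rewrite subr_ge0 (ltW mus) /=.
  by rewrite lerBlDr lerDl.
exists (p / D); split=> [|t mut].
  by rewrite divr_gt0 // ltr_pdivrMr // mul1r; lra.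
rewrite (le_lt_trans (ler_normD _ _)) // normrM ger0_norm ?divr_ge0 1?ltW //.
have dD : `|delta t| < D.
  rewrite /D (bigD1 t) //= addrA ltr_wpDr ?sumr_ge0 //; lra.
have : p / D * `|delta t| < p by rewrite mulrAC ltr_pdivrMr // ltr_pM2l.
have := p_le t mut; lra.
Qed.

Definition edge_end x w : Prop :=
  [/\ \sum_t `|ev (L t) w| = 1,
      forall t, Num.sg (ev (L t) x) * ev (L t) w = `|ev (L t) w|,
      0 < det2 (pi x) (pi w)
    & forall t, ev (L t) x = 0 -> ev (L t) w = 0].

Lemma edge_endpoint x : edge_point x ->
  exists w, edge_end x w /\ vertices (pi @` Z) (pi w).
Proof.
move=> ex; have [solve [mu [mu_sg mu_lt1 mu_pl]] [y [ty xy]]] := ex.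
have [t0 t0x] : exists t, ev (L t) x != 0.
  apply/existsP; rewrite -[X in is_true X]negbK negb_exists; apply/negP => /forallP x0.
  suff x_0 : x = 0 by move: xy; rewrite x_0 /det2 !mxE !mul0r subrr ltxx.
  by apply: ev_separates => t; apply/eqP; have := x0 t; rewrite negbK.
(* Row [t] vanishes on [c *: x + y] at [c = tau t]. The largest such parameter is the first one met
   when [c] decreases from infinity, so no sign has flipped yet. *)
pose tau t := - ev (L t) y / ev (L t) x.
case: (@arg_maxP _ _ _ t0 (fun t => ev (L t) x != 0) tau t0x) => t1 /= t1x tau_max.
pose w := tau t1 *: x + y.
have w_compat t : Num.sg (ev (L t) x) * ev (L t) w = `|ev (L t) w|.
  rewrite /w evDr evZr; have [tx|tx] := eqVneq (ev (L t) x) 0.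
    by rewrite tx ty // mulr0 addr0 mulr0 normr0.
  have -> : tau t1 * ev (L t) x + ev (L t) y = (tau t1 - tau t) * ev (L t) x.
    by rewrite /tau; field; rewrite tx t1x.
  rewrite mulrCA normrM -normrEsg ger0_norm // subr_ge0; exact: tau_max.
have xw : 0 < det2 (pi x) (pi w).
  have <- : det2 (pi x) (pi y) = det2 (pi x) (pi w).
    by rewrite /w projD projZ /det2 !mxE; ring.
  exact: xy.
have t1w : ev (L t1) w = 0.
  by rewrite /w evDr evZr /tau; field.
have tw t : ev (L t) x = 0 -> ev (L t) w = 0.
  by move=> tx; rewrite /w evDr evZr tx ty // mulr0 addr0.
pose h := \sum_t `|ev (L t) w|.
have h_gt0 : 0 < h.
  rewrite lt_neqAle sumr_ge0 // andbT; apply/eqP => /esym h0.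
  suff w_0 : w = 0 by move: xw; rewrite w_0 /det2 !mxE !mulr0 subrr ltxx.
  apply: ev_separates => t; apply/eqP; rewrite -normr_eq0; apply/eqP.
  by apply: (psumr_eq0P _ h0).
have evw t : ev (L t) (h^-1 *: w) = h^-1 * ev (L t) w by rewrite evZr.
exists (h^-1 *: w); split; [split|].
- under eq_bigr do rewrite evw normrM.
  by rewrite -mulr_sumr ger0_norm ?invr_ge0 1?ltW // mulVf // gt_eqF.
- by move=> t; rewrite evw mulrCA w_compat normrM (ger0_norm (_ : 0 <= h^-1)) // invr_ge0 ltW.
- by rewrite projZ det2Zr mulr_gt0 // invr_gt0.
- by move=> t /tw; rewrite evw => ->; rewrite mulr0.
have [delta [d0 d_pl]] := solve (L t1).
have mu_le1 t : `|mu t| <= 1.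
  have [tx|tx] := eqVneq (ev (L t) x) 0; first by rewrite ltW // mu_lt1.
  by rewrite mu_sg // normr_sg tx.
(* [D] moves the multiplier of [t1] towards 0 and, through [delta], restores planarity using only
   rows vanishing at [x], whose strict bounds survive a small [e]. *)
pose D t := - mu t1 * ((t == t1)%:R + delta t).
have [e [/andP[e_gt0 e_lt1] mu_e]] := small_perturbation mu D.
have mu_t1 : mu t1 = 1 \/ mu t1 = -1.
  by rewrite mu_sg //; case: sgrP t1x => //; [left|right].
pose mu' t := mu t + e * D t.
have mu't t : ev (L t) x != 0 -> t != t1 -> mu' t = mu t.
  by move=> tx tt1; rewrite /mu' /D (negbTE tt1) d0 // addr0 !mulr0 addr0.
have mu't1 : `|mu' t1| < 1.
  by rewrite /mu' /D eqxx d0 //= addr0 ltr_norml; case: mu_t1 => ->; apply/andP; split; lra.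
have mu'_lt1 t : ev (L t) x = 0 -> `|mu' t| < 1 by move/mu_lt1/mu_e.
apply: (@vertex_criterion mu').
- move=> t; have [/mu'_lt1/ltW //|tx] := eqVneq (ev (L t) x) 0.
  by have [->|tt1] := eqVneq t t1; [apply: ltW | rewrite mu't].
- have -> : \sum_t mu' t *: L t =
      \sum_t mu t *: L t + (- (e * mu t1)) *: (L t1 + \sum_t delta t *: L t).
    rewrite scalerDr scaler_sumr.
    have -> : (- (e * mu t1)) *: L t1 = \sum_t (- (e * mu t1) * (t == t1)%:R) *: L t.
      rewrite (bigD1 t1) //= eqxx mulr1 big1 ?addr0 // => t /negbTE ->.
      by rewrite mulr0 scale0r.
    rewrite -!big_split /=; apply: eq_bigr => t _.
    rewrite scalerA -!scalerDl; congr (_ *: _); rewrite /mu' /D; ring.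
  by apply: planarD => //; apply: planarZ.
- under eq_bigr do rewrite evw normrM.
  by rewrite -mulr_sumr ger0_norm ?invr_ge0 1?ltW // mulVf // gt_eqF.
- move=> t; rewrite evw mulrCA normrM (ger0_norm (_ : 0 <= h^-1)) ?invr_ge0 1?ltW //.
  congr (_ * _); have [tx|tx] := eqVneq (ev (L t) x) 0.
    by rewrite tw // mulr0 normr0.
  have [->|tt1] := eqVneq t t1; first by rewrite t1w mulr0 normr0.
  by rewrite mu't // mu_sg.
(* The rows vanishing at [x] confine [z] to the plane of [x] and [w]; row [t1] vanishes at [w] but
   not at [x], which removes the [x] component. *)
- move=> z tz; have [a [b zab]] : exists a b, z = a *: x + b *: w.
    apply: edge_tight_span ex tw _ _; last by rewrite gt_eqF.
    by move=> t /mu'_lt1 /tz.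
  have : ev (L t1) z = 0 by apply: tz.
  rewrite zab evDr !evZr t1w mulr0 addr0 => /eqP; rewrite mulf_eq0 (negbTE t1x) orbF.
  by move=> /eqP ->; exists (b * h); rewrite scale0r add0r scalerA mulfK // gt_eqF.
Qed.

Lemma edge_multiplier_norm x mu : edge_multiplier x mu ->
  (forall t, `|mu t| <= 1) /\ forall t, mu t * ev (L t) x = `|ev (L t) x|.
Proof.
move=> [mu_sg mu_lt1 _]; split=> t; have [tx|tx] := eqVneq (ev (L t) x) 0.
- by rewrite ltW // mu_lt1.
- by rewrite mu_sg // normr_sg tx.
- by rewrite tx mulr0 normr0.
- by rewrite mu_sg // -normrEsg.
Qed.

Lemma edge_end_ev x mu w : edge_multiplier x mu -> edge_end x w ->
  ev (\sum_t mu t *: L t) w = 1.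
Proof.
move=> [mu_sg _ _] [w1 sg_w _ tw]; rewrite ev_sum -w1; apply: eq_bigr => t _.
have [/tw ->|tx] := eqVneq (ev (L t) x) 0; first by rewrite mulr0 normr0.
by rewrite mu_sg // sg_w.
Qed.

(* The two supporting lines both pass through [pi w], and the edges leave it on
   the same side, so each line supports the other edge. *)
Lemma edge_end_transfer x x' w w' mu mu' :
  edge_multiplier x mu -> edge_multiplier x' mu' ->
  edge_end x w -> edge_end x' w' -> pi w = pi w' ->
  forall t, mu t * ev (L t) x' = `|ev (L t) x'|.
Proof.
move=> mx mx' wx wx' ww'.
have [mu1 mu_x] := edge_multiplier_norm mx.
have [mu1' mu_x'] := edge_multiplier_norm mx'.
have [_ _ pl] := mx; have [_ _ pl'] := mx'.
have [_ _ xw _] := wx; have [_ _ xw' _] := wx'.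
set M := \sum_t mu t *: L t in pl *; set M' := \sum_t mu' t *: L t in pl' *.
pose h z : R := \sum_t `|ev (L t) z|.
have Mx : ev M x = h x by rewrite ev_sum; apply: eq_bigr.
have Mx' : ev M' x' = h x' by rewrite ev_sum; apply: eq_bigr.
have [a [b x'ab]] : exists a b, pi x' = a *: pi x + b *: pi w.
  by apply: det2_basis; rewrite gt_eqF.
have a_gt0 : 0 < a.
  move: xw'; rewrite -ww' x'ab.
  have -> : det2 (a *: pi x + b *: pi w) (pi w) = a * det2 (pi x) (pi w).
    by rewrite /det2 !mxE; ring.
  by rewrite pmulr_lgt0.
apply: ev_eq_norm1 => //; rewrite -/M -/(h x').
have M'w : ev (plane_form M') (pi w) = 1.
  by rewrite ww' ev_plane_form // (edge_end_ev mx' wx').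
have Mw : ev (plane_form M) (pi w) = 1.
  by rewrite ev_plane_form // (edge_end_ev mx wx).
(* Both forms equal 1 at the common end, so expanding [pi x'] along [pi x] and [pi w] turns
   [ev M' x <= h x] into [h x' <= ev M x']. *)
have E : ev M x' = a * h x + b.
  by rewrite -ev_plane_form // x'ab evDr !evZr Mw mulr1 ev_plane_form // Mx.
have E' : h x' = a * ev M' x + b.
  by rewrite -Mx' -ev_plane_form // x'ab evDr !evZr M'w mulr1 ev_plane_form.
by rewrite E E' lerD2r ler_pM2l // ev_le_norm1.
Qed.

(** By symmetry each multiplier is compatible with the signs at the other point. Where its modulus
    is below 1 this forces a common zero; elsewhere it is the sign itself. *)
Lemma edge_end_inj x x' w w' mu mu' :
  edge_multiplier x mu -> edge_multiplier x' mu' ->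
  edge_end x w -> edge_end x' w' -> pi w = pi w' ->
  forall t, Num.sg (ev (L t) x) = Num.sg (ev (L t) x').
Proof.
move=> mx mx' wx wx' ww' t.
have xx' := edge_end_transfer mx mx' wx wx' ww' t.
have x'x := edge_end_transfer mx' mx wx' wx (esym ww') t.
have [mu_sg mu_lt1 _] := mx; have [mu_sg' mu_lt1' _] := mx'.
have [tx|tx] := eqVneq (ev (L t) x) 0.
  by rewrite tx (mult_tight (mu_lt1 t tx) xx').
have [tx'|tx'] := eqVneq (ev (L t) x') 0.
  by rewrite tx' (mult_tight (mu_lt1' t tx') x'x).
move: xx'; rewrite mu_sg // normrEsg => /(mulIf tx') //.
Qed.

Lemma card_edge_points (I : finType) (X : I -> 'cV[R]_N.+2) :
  (forall i, edge_point (X i)) ->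
  (forall i j, (forall t, Num.sg (ev (L t) (X i)) = Num.sg (ev (L t) (X j))) -> i = j) ->
  `I_#|I| #<= vertices (pi @` Z).
Proof.
move=> eX sgX; have [W HW] := choice (fun i => edge_endpoint (eX i)).
have injW : injective (pi \o W).
  move=> i j /= Wij; apply: sgX.
  have [mu mi] := ep_mult (eX i); have [mu' mj] := ep_mult (eX j).
  exact: edge_end_inj mi mj (HW i).1 (HW j).1 Wij.
have cI : `I_#|I| #= [set: I].
  rewrite (card_eql card_II) card_eq_sym.
  have -> : [set: 'I_#|I|] = enum_rank @` [set: I].
    by apply/seteqP; split=> // i _; exists (enum_val i); rewrite ?enum_valK.
  by rewrite card_eq_sym; exact: inj_card_eq (in2W enum_rank_inj).
rewrite (card_le_eql cI).
have cW : [set: I] #= (pi \o W) @` [set: I].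
  by rewrite card_eq_sym; exact: inj_card_eq (in2W injW).
rewrite (card_le_eql cW).
by apply: subset_card_le => _ [i _ <-]; exact: (HW i).2.
Qed.

End ProjectedPolar.

(** * Rows of the stacked matrix *)

(** Solves triangular systems backwards from the last block: the coordinates of a sample, the
    planarity corrections and the multipliers are all obtained so. *)
Lemma downward_rec (S : Type) (F : nat -> S -> S) M v :
  exists f : nat -> S, f M = v /\ forall i, (i < M)%N -> f i = F i (f i.+1).
Proof.
elim: M F => [|M IH] F; first by exists (fun=> v).
have [f [fM fF]] := IH (fun i => F i.+1).
exists (fun i => if i is i'.+1 then f i' else F 0%N (f 0%N)); split=> // -[|i] //=.
by rewrite ltnS => /fF.
Qed.

(** The sum of absolute values is the maximum of the [2 ^ m] signed sums, which gives the
    inequalities; a left inverse of [A] bounds each coordinate. *)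
Lemma dual_zonotope_polytope (R : realType) m d (A : 'M[R]_(m, d)) :
  row_full A -> polytope (dual_zonotope A).
Proof.
move=> /row_fullP[B BA]; split.
  pose C := \matrix_(q < #|{ffun 'I_m -> bool}|, c < d)
    \sum_j (-1) ^+ (enum_val q j : bool) * A j c.
  have CE q x : (C *m x) q 0 = \sum_j (-1) ^+ (enum_val q j : bool) * (row j A *m x) 0 0.
    rewrite mxE; under eq_bigr do rewrite mxE mulr_suml.
    rewrite exchange_big; apply: eq_bigr => j _ /=.
    by rewrite mxE mulr_sumr; apply: eq_bigr => c _; rewrite mxE mulrA.
  exists _, C, (const_mx 1); apply/seteqP; split=> x /=.
    move=> xZ q; rewrite CE mxE; apply: le_trans xZ; apply: ler_sum => j _.
    by rewrite (le_trans (ler_norm _)) // normrM normr_sign mul1r.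
  rewrite /dual_zonotope /= => xC.
  pose s := [ffun j => (row j A *m x) 0 0 < 0].
  have := xC (enum_rank s); rewrite CE mxE enum_rankK; apply: le_trans.
  by apply: ler_sum => j _; rewrite ffunE -normrEsign.
exists (\sum_i \sum_j `|B i j|) => x xZ i.
have -> : x i 0 = \sum_j B i j * (row j A *m x) 0 0.
  rewrite -[x in LHS]mul1mx -BA -mulmxA mxE; apply: eq_bigr => j _.
  by rewrite -row_mul [in RHS]mxE.
rewrite (le_trans (ler_norm_sum _ _ _)) // (bigD1 i) //= ler_wpDr ?sumr_ge0 //.
  by move=> l _; apply: sumr_ge0.
apply: ler_sum => j _; rewrite normrM ler_piMr //.
apply: le_trans xZ; rewrite (bigD1 j) //= lerDl; exact: sumr_ge0.
Qed.

Lemma row_fullP0 (F : fieldType) m d (A : 'M[F]_(m, d)) :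
  (forall x : 'cV_d, A *m x = 0 -> x = 0) -> row_full A.
Proof.
move=> A0; rewrite /row_full -mxrank_tr; apply: inj_row_free => v vA.
apply: trmx_inj; rewrite trmx0; apply: A0; apply: trmx_inj.
by rewrite trmx_mul trmxK vA trmx0.
Qed.

Section StackRows.
Variables (R : realType) (k N : nat).
Local Notation n := (4 * k + 1)%N.
Local Notation a := (alpha R k).
Local Notation b := (Defs.col0 R k).
Local Notation s := (sgn_col R k).

(** Rows are indexed by pairs of a block and a row inside it; blocks count from 0, so [p.1] stands
    for the block [A_(p.1 + 1)]. *)
Definition stack_row (p : 'I_N.+1 * 'I_n) : 'rV[R]_N.+2 :=
  a ^+ p.1 *: row p.2 (block R k N.+2 p.1.+1).

Definition stack_index (p : 'I_N.+1 * 'I_n) : 'I_(N.+1 * n) :=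
  cast_ord (sum_rows N.+1 n) (tagnat.Rank p.1 p.2).

Lemma row_stackA p : row (stack_index p) (stackA R k N.+2) = stack_row p.
Proof.
apply/rowP => c; rewrite /stackA mxE castmxE /= /stack_index cast_ordK cast_ord_id.
pose B (i : 'I_N.+1) := a ^+ i *: block R k N.+2 i.+1.
have /matrixP/(_ p.2 c) := mxcolK B p.1.
by rewrite /submxcol mxE => ->; rewrite /stack_row /B !mxE.
Qed.

Lemma stack_index_bij : bijective stack_index.
Proof.
pose g (t : 'I_(N.+1 * n)) : 'I_N.+1 * 'I_n :=
  let t' := cast_ord (esym (sum_rows N.+1 n)) t in (tagnat.sig1 t', tagnat.sig2 t').
have gK : cancel g stack_index.
  by move=> t; rewrite /stack_index /g /= tagnat.sig2K cast_ordKV.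
have inj : injective stack_index.
  move=> [i j] [i' j'] /cast_ord_inj/(congr1 val)/eqP.
  by rewrite tagnat.eq_Rank /= => /andP[/eqP -> /eqP/val_inj ->].
by exists g => // p; apply: inj; rewrite gK.
Qed.

Lemma alpha_gt0 : 0 < a.
Proof. by rewrite invr_gt0 ltr0n addn1. Qed.

(** That [n * alpha] is below 1 keeps both coordinates and multipliers small when passing from one
    block to the preceding one. *)
Lemma natr_alpha : n%:R * a = 1 - a.
Proof.
have : (n + 1)%:R * a = 1 by rewrite /alpha mulfV // pnatr_eq0 addn1.
by rewrite natrD mulrDl mul1r; lra.
Qed.

Definition vec (X : nat -> R) : 'cV[R]_N.+2 := \col_c X c.

Lemma stack_rowE p c : stack_row p 0 c =
  a ^+ p.1 * ((c == 0%N :> nat)%:R * (a ^+ p.1 * b p.2)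
              + (c == p.1.+1 :> nat)%:R * s p.2 + (c == p.1.+2 :> nat)%:R).
Proof.
rewrite !mxE; congr (_ * _).
case: eqVneq => [->|_]; first by rewrite /= !mul1r !mul0r !addr0.
rewrite mul0r add0r.
case: eqVneq => [->|_]; first by rewrite (ltn_eqF (ltnSn p.1.+1)) mul1r addr0.
by rewrite mul0r add0r; case: eqP.
Qed.

Lemma sum_indicator D (F : nat -> R) m :
  \sum_(c < D) (c == m :> nat)%:R * F c = (m < D)%:R * F m.
Proof.
have [mD|Dm] := ltnP m D; last first.
  rewrite mul0r big1 // => c _; rewrite (ltn_eqF (leq_trans (ltn_ord c) Dm)).
  by rewrite mul0r.
rewrite (bigD1 (Ordinal mD)) //= eqxx big1 ?addr0 // => c /negbTE.
by rewrite -val_eqE /= => ->; rewrite mul0r.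
Qed.

(** The factor [(p.1 < N)%:R] reflects the all-ones column omitted from the last block. *)
Lemma ev_stack_row (X : nat -> R) p : ev (stack_row p) (vec X) =
  a ^+ p.1 * (a ^+ p.1 * b p.2 * X 0%N + s p.2 * X p.1.+1
              + (p.1 < N)%:R * X p.1.+2).
Proof.
rewrite /ev mxE.
under eq_bigr do rewrite stack_rowE [X in _ * X]mxE -mulrA mulrDl mulrDl -!mulrA.
rewrite -mulr_sumr !big_split /=; congr (_ * (_ + _ + _)).
- by rewrite (sum_indicator _ (fun c => a ^+ p.1 * (b p.2 * X c))) mul1r mulrA.
- by rewrite (sum_indicator _ (fun c => s p.2 * X c)) ltnS ltn_ord mul1r.
- by rewrite (sum_indicator _ X).
Qed.

(** Only two blocks meet column [i.+2]: block [i] in its all-ones column and block [i.+1] in its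
    sign column. *)
Lemma comb_coord (nu : nat -> nat -> R) i (c : 'I_N.+2) : c = i.+2 :> nat ->
  (\sum_(p : 'I_N.+1 * 'I_n) nu p.1 p.2 *: stack_row p) 0 c =
  a ^+ i * \sum_(j < n) nu i j + a ^+ i.+1 * \sum_(j < n) s j * nu i.+1 j.
Proof.
move=> ci; rewrite summxE; under eq_bigr do rewrite mxE stack_rowE ci /= mul0r add0r.
have iN : (i < N)%N by rewrite -2!ltnS -ci.
rewrite -(pair_bigA _ (fun (l : 'I_N.+1) (j : 'I_n) => nu l j *
  (a ^+ l * ((i.+2 == l.+1)%:R * s j + (i.+2 == l.+2)%:R)))) /=.
have -> : \sum_(l < N.+1) \sum_(j < n) nu l j * (a ^+ l *
      ((i.+2 == l.+1)%:R * s j + (i.+2 == l.+2)%:R)) =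
    \sum_(l < N.+1) (l == i :> nat)%:R * (a ^+ l * \sum_(j < n) nu l j) +
    \sum_(l < N.+1) (l == i.+1 :> nat)%:R * (a ^+ l * \sum_(j < n) s j * nu l j).
  rewrite -big_split; apply: eq_bigr => l _ /=; rewrite !mulr_sumr -big_split.
  apply: eq_bigr => j _ /=; rewrite !eqSS ![_ == l :> nat]eq_sym; ring.
rewrite (sum_indicator _ (fun l => a ^+ l * \sum_(j < n) nu l j)).
rewrite (sum_indicator _ (fun l => a ^+ l * \sum_(j < n) s j * nu l j)).
by rewrite !ltnS iN ltnW // !mul1r.
Qed.

Lemma sum_sgr M c c' (F : nat -> R) : (c <= c' <= M)%N ->
  (forall j, (j < c)%N -> 0 < F j) -> (forall j, (c <= j < c')%N -> F j = 0) ->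
  (forall j, (c' <= j < M)%N -> F j < 0) ->
  \sum_(j < M) Num.sg (F j) = (c + c')%:R - M%:R.
Proof.
move=> /andP[cc' c'M] Fpos F0 Fneg.
rewrite -(big_mkord xpredT (fun j => Num.sg (F j))).
rewrite (big_cat_nat (n := c')) //= (big_cat_nat (n := c)) //=.
rewrite (eq_big_nat _ _ (F2 := fun=> 1)); last by move=> j /Fpos/gtr0_sg.
rewrite [X in _ + X + _](eq_big_nat _ _ (F2 := fun=> 0)); last first.
  by move=> j /F0 ->; rewrite sgr0.
rewrite [X in _ + X](eq_big_nat _ _ (F2 := fun=> -1)); last first.
  by move=> j /Fneg/ltr0_sg.
rewrite !sumr_const_nat subn0 mul0rn addr0 mulNrn natrB // natrD; lra.
Qed.

Lemma sum_rows_split (G : nat -> R) : \sum_(j < n) G j =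
  \sum_(j < 2 * k + 1) G j + \sum_(p < 2 * k) G (2 * k + 1 + p)%N.
Proof.
have -> : n = (2 * k + 1 + 2 * k)%N by lia.
by rewrite big_split_ord.
Qed.

Lemma col0_lo j : (j < 2 * k + 1)%N -> b j = k%:R - j%:R.
Proof. by rewrite /Defs.col0 => ->. Qed.

Lemma col0_hi p : b (2 * k + 1 + p) = - k%:R + 2^-1 + p%:R.
Proof. by rewrite /Defs.col0 ltnNge leq_addr /= addKn. Qed.

Lemma sgn_lo j : (j < 2 * k + 1)%N -> s j = 1.
Proof. by rewrite /sgn_col => ->. Qed.

Lemma sgn_hi p : s (2 * k + 1 + p) = -1.
Proof. by rewrite /sgn_col ltnNge leq_addr. Qed.

Lemma rows_ind (P : nat -> Prop) :
  (forall j, (j < 2 * k + 1)%N -> P j) ->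
  (forall p, (p < 2 * k)%N -> P (2 * k + 1 + p)%N) ->
  forall j, (j < n)%N -> P j.
Proof.
move=> lo hi j jn; have [/lo //|hj] := ltnP j (2 * k + 1).
by rewrite -(subnKC hj); apply: hi; lia.
Qed.

(** A row of a block without its positive factor, at a point with coordinate 0 equal to 1: [be] is a
    power of alpha, [y] sits under the sign column, [z] under the all-ones column. *)
Definition entry (be z y : R) j : R := be * b j + s j * y + z.

(** The [y] at which row [j] vanishes, since [s j] squares to 1. *)
Definition root (be z : R) j : R := - s j * (z + be * b j).

Lemma entry_root_same be z j0 j : s j = s j0 ->
  entry be z (root be z j0) j = be * (b j - b j0).
Proof.
rewrite /entry /root => ->.
have ss : s j0 * s j0 = 1 by rewrite /sgn_col; case: ifP => _; ring.
by rewrite mulrA mulrN ss; ring.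
Qed.

Lemma entry_root_opp be z j0 j : s j = - s j0 ->
  entry be z (root be z j0) j = be * (b j + b j0) + 2 * z.
Proof.
rewrite /entry /root => ->.
have ss : s j0 * s j0 = 1 by rewrite /sgn_col; case: ifP => _; ring.
by rewrite mulrA mulrNN ss; ring.
Qed.

(* Along the line [entry be z _ j0 = 0] the zeros of the rows with sign +1 and
   those with sign -1 alternate, because [z] is small. *)
Lemma entry_root_signs be z j0 : 0 < be -> `|z| < be / 4 -> (j0 < n)%N ->
  (forall j, (j < n)%N -> j != j0 -> entry be z (root be z j0) j != 0) /\
  \sum_(j < n) Num.sg (entry be z (root be z j0) j) = 0.
Proof.
move=> be0; rewrite ltr_norml => /andP[z1 z2]; move: j0; apply: rows_ind => [j0|p0] h0.
  have lo j : (j < 2 * k + 1)%N ->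
      entry be z (root be z j0) j = be * (j0%:R - j%:R).
    move=> hj; rewrite entry_root_same; last by rewrite !sgn_lo.
    by rewrite !col0_lo //; ring.
  have hi p : entry be z (root be z j0) (2 * k + 1 + p) =
      be * (p%:R + 2^-1 - j0%:R) + 2 * z.
    rewrite entry_root_opp; last by rewrite sgn_hi sgn_lo.
    by rewrite col0_hi col0_lo //; ring.
  (* The bracket is a half-integer, so its product with [be] is at least [be / 2] in modulus, while
     [2 * z] stays strictly below that. *)
  have hi_gt p : (j0 <= p)%N -> 0 < be * (p%:R + 2^-1 - j0%:R) + 2 * z.
    rewrite -(ler_nat R) -subr_ge0 => jp; have := mulr_ge0 (ltW be0) jp; lra.
  have hi_lt p : (p < j0)%N -> be * (p%:R + 2^-1 - j0%:R) + 2 * z < 0.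
    rewrite -(ler_nat R) -addn1 natrD -subr_ge0 => jp.
    have := mulr_ge0 (ltW be0) jp; lra.
  split.
    apply: rows_ind => [j hj jj0|p hp _].
      by rewrite lo // mulf_neq0 ?(gt_eqF be0) // subr_eq0 eqr_nat eq_sym.
    rewrite hi; have [/hi_gt/gt_eqF ->//|/hi_lt/lt_eqF ->//] := leqP j0 p.
  (* The rows of sign +1 contribute [2 * j0 - 2 * k] and those of sign -1 the opposite; the latter
     increase with [p] and are negated to fit [sum_sgr]. *)
  rewrite (sum_rows_split (fun j => Num.sg (entry be z (root be z _) j))).
  rewrite (@sum_sgr _ j0 j0.+1 (entry be z (root be z j0))); first last.
  - move=> j /andP[jj0 hj]; rewrite lo // pmulr_rlt0 // subr_lt0 ltr_nat //.
  - move=> j hj; have -> : j = j0 by lia.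
    by rewrite lo // subrr mulr0.
  - by move=> j hj; rewrite lo 1?pmulr_rgt0 ?subr_gt0 ?ltr_nat //; lia.
  - by rewrite leqnSn.
  under eq_bigr do rewrite hi -[X in Num.sg X]opprK sgrN.
  rewrite sumrN (@sum_sgr _ j0 j0 (fun p => - (be * (p%:R + 2^-1 - j0%:R) + 2 * z))); first last.
  - by move=> p /andP[/hi_gt]; rewrite oppr_lt0.
  - by move=> j /andP[] /leq_ltn_trans h /h; rewrite ltnn.
  - by move=> p /hi_lt; rewrite oppr_gt0.
  - by rewrite leqnn; lia.
  rewrite -[j0.+1]addn1 !natrD; lra.
have hi p : entry be z (root be z (2 * k + 1 + p0)) (2 * k + 1 + p) =
    be * (p%:R - p0%:R).
  by rewrite entry_root_same ?sgn_hi // !col0_hi; ring.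
have lo j : (j < 2 * k + 1)%N -> entry be z (root be z (2 * k + 1 + p0)) j =
    be * (p0%:R + 2^-1 - j%:R) + 2 * z.
  move=> hj; rewrite entry_root_opp; last by rewrite sgn_hi sgn_lo // opprK.
  by rewrite col0_hi col0_lo //; ring.
have lo_gt j : (j <= p0)%N -> 0 < be * (p0%:R + 2^-1 - j%:R) + 2 * z.
  rewrite -(ler_nat R) -subr_ge0 => jp; have := mulr_ge0 (ltW be0) jp; lra.
have lo_lt j : (p0 < j)%N -> be * (p0%:R + 2^-1 - j%:R) + 2 * z < 0.
  rewrite -(ler_nat R) -addn1 natrD -subr_ge0 => jp.
  have := mulr_ge0 (ltW be0) jp; lra.
split.
  apply: rows_ind => [j hj _|p hp jj0].
    rewrite lo //; have [/lo_gt/gt_eqF ->//|/lo_lt/lt_eqF ->//] := leqP j p0.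
  rewrite hi mulf_neq0 ?(gt_eqF be0) // subr_eq0 eqr_nat.
  by move: jj0; rewrite eqn_add2l.
rewrite (sum_rows_split (fun j => Num.sg (entry be z (root be z _) j))).
rewrite (@sum_sgr _ p0.+1 p0.+1 (entry be z (root be z (2 * k + 1 + p0)))); first last.
- by move=> j /andP[jj0 hj]; rewrite lo // lo_lt.
- by move=> j /andP[] /leq_ltn_trans h /h; rewrite ltnn.
- by move=> j hj; rewrite lo ?lo_gt //; lia.
- by rewrite leqnn; lia.
under eq_bigr do rewrite hi -[X in Num.sg X]opprK sgrN.
rewrite sumrN (@sum_sgr _ p0 p0.+1 (fun p => - (be * (p%:R - p0%:R)))); first last.
- by move=> p /andP[hp _]; rewrite oppr_lt0 pmulr_rgt0 // subr_gt0 ltr_nat.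
- move=> p hp; have -> : p = p0 by lia.
  by rewrite subrr mulr0 oppr0.
- by move=> p hp; rewrite oppr_gt0 pmulr_rlt0 // subr_lt0 ltr_nat.
- by rewrite leqnSn.
rewrite -[p0.+1]addn1 !natrD; lra.
Qed.

(* The zeros of the rows of the last block are the [a ^+ N * (m / 2)] with
   [- 2k <= m <= 2k]; [last_coord 0], ..., [last_coord n] are interlaced with them. *)
Definition last_coord r : R := a ^+ N * (r%:R / 2 - k%:R - 4^-1).

(** Coordinate 0 is normalised to 1, and row [J i] vanishes in each block [i < N]; [r] names the gap
    of the last coordinate. *)
Definition sample (J : nat -> nat) r (X : nat -> R) : Prop :=
  [/\ X 0%N = 1, X N.+1 = last_coord r
    & forall i, (i < N)%N -> X i.+1 = root (a ^+ i) (X i.+2) (J i)].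

Lemma exists_sample J r : exists X, sample J r X.
Proof.
have [f [fN fF]] := downward_rec (fun i y => root (a ^+ i) y (J i)) N (last_coord r).
by exists (fun i => if i is i'.+1 then f i' else 1).
Qed.

Definition row_val X i j : R := entry (a ^+ i) ((i < N)%:R * X i.+2) (X i.+1) j.

Lemma ev_vec (X : nat -> R) p : X 0%N = 1 ->
  ev (stack_row p) (vec X) = a ^+ p.1 * row_val X p.1 p.2.
Proof. by move=> X0; rewrite ev_stack_row X0 mulr1. Qed.

Lemma expa_gt0 i : 0 < a ^+ i.
Proof. exact: exprn_gt0 alpha_gt0. Qed.

Lemma sgr_ev_vec (X : nat -> R) p : X 0%N = 1 ->
  Num.sg (ev (stack_row p) (vec X)) = Num.sg (row_val X p.1 p.2).
Proof. by move=> X0; rewrite ev_vec // sgrM gtr0_sg ?mul1r // expa_gt0. Qed.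

Lemma ev_vec_eq0 (X : nat -> R) p : X 0%N = 1 ->
  (ev (stack_row p) (vec X) == 0) = (row_val X p.1 p.2 == 0).
Proof. by move=> X0; rewrite ev_vec // mulf_eq0 gt_eqF // expa_gt0. Qed.

Lemma normr_col0 j : (j < n)%N -> `|b j| <= k%:R.
Proof.
move: j; apply: rows_ind => [j hj|p hp].
  rewrite col0_lo // ler_norml.
  have : j%:R <= (2 * k)%:R :> R by rewrite ler_nat; lia.
  by rewrite natrM; have := ler0n R j; lra.
rewrite col0_hi ler_norml.
have : p%:R + 1 <= (2 * k)%:R :> R by rewrite natr1 ler_nat; lia.
by rewrite natrM; have := ler0n R p; lra.
Qed.

(** * Size and sign patterns of the samples *)

Section Sample.
Variables (J : nat -> nat) (r : nat) (X : nat -> R).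
Hypotheses (hJ : forall i, (J i < n)%N) (hr : (r <= n)%N) (hX : sample J r X).

(** Downward induction: [n / 4 = k + 1 / 4], the entries of column 0 contribute at most [k], and the
    next coordinate at most [alpha * n / 4 < 1 / 4]. *)
Lemma sample_bound i : (i <= N)%N -> `|X i.+1| <= a ^+ i * (n%:R / 4).
Proof.
have [_ XN Xroot] := hX.
move=> iN; rewrite -(subKn iN); elim: (N - i)%N (leq_subr i N) => [_|m IH mN].
  rewrite subn0 XN normrM (ger0_norm (ltW (expa_gt0 _))) ler_pM2l ?expa_gt0 //.
  have : r%:R <= n%:R :> R by rewrite ler_nat.
  by rewrite ler_norml natrD natrM; have := ler0n R r; lra.
have := IH (ltnW mN); rewrite -(subnSK mN); set l := (N - m.+1)%N => Xl.
have lN : (l < N)%N by rewrite /l; lia.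
rewrite Xroot // /root normrM normrN.
have -> : `|s (J l)| = 1 by rewrite /sgn_col; case: ifP; rewrite ?normrN normr1.
rewrite mul1r (le_trans (ler_normD _ _)) // normrM (ger0_norm (ltW (expa_gt0 _))).
have := ler_wpM2l (ltW (expa_gt0 l)) (normr_col0 (hJ l)).
move: Xl; rewrite exprSr -mulrA [a * _]mulrA [a * _]mulrC natr_alpha.
have := expa_gt0 l; have := mulr_gt0 (expa_gt0 l) alpha_gt0.
rewrite natrD natrM; lra.
Qed.

Lemma sample_small i : (i < N)%N -> `|X i.+2| < a ^+ i / 4.
Proof.
move=> /sample_bound /le_lt_trans; apply.
rewrite exprSr -mulrA [a * _]mulrA [a * _]mulrC natr_alpha.
have := expa_gt0 i; have := mulr_gt0 (expa_gt0 i) alpha_gt0; lra.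
Qed.

Lemma sample_entry i j : (i < N)%N ->
  row_val X i j = entry (a ^+ i) (X i.+2) (root (a ^+ i) (X i.+2) (J i)) j.
Proof. by move=> iN; have [_ _ <-//] := hX; rewrite /row_val iN mul1r. Qed.

Lemma sample_entry_same i j : (i < N)%N -> s j = s (J i) ->
  row_val X i j = a ^+ i * (b j - b (J i)).
Proof. by move=> iN sj; rewrite sample_entry // entry_root_same. Qed.

(** The thresholds [4 * j + 1] here and [4 * p + 3] for sign -1 are odd, so the even number [2 * r]
    never hits them. *)
Lemma sample_last_lo j : (j < 2 * k + 1)%N ->
  row_val X N j = a ^+ N / 4 * ((2 * r)%:R - (4 * j + 1)%:R).
Proof.
move=> hj; have [_ XN _] := hX.
rewrite /row_val /entry ltnn mul0r addr0 XN sgn_lo // col0_lo // /last_coord.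
by rewrite natrD !natrM; field.
Qed.

Lemma sample_last_hi p :
  row_val X N (2 * k + 1 + p) = a ^+ N / 4 * ((4 * p + 3)%:R - (2 * r)%:R).
Proof.
have [_ XN _] := hX.
rewrite /row_val /entry ltnn mul0r addr0 XN sgn_hi col0_hi /last_coord.
by rewrite natrD !natrM; field.
Qed.

Lemma sample_eq0 i j : (i <= N)%N -> (j < n)%N ->
  (row_val X i j == 0) = (i < N)%N && (j == J i).
Proof.
rewrite leq_eqVlt => /orP[/eqP ->|iN] jn.
  rewrite ltnn /=; apply/negbTE; move: j jn; apply: rows_ind => [j hj|p hp].
    rewrite sample_last_lo // mulf_neq0 ?(gt_eqF (divr_gt0 (expa_gt0 _) _)) //.
    by rewrite subr_eq0 eqr_nat; lia.
  rewrite sample_last_hi mulf_neq0 ?(gt_eqF (divr_gt0 (expa_gt0 _) _)) //.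
  by rewrite subr_eq0 eqr_nat; lia.
rewrite iN /=; have [->|jJ] := eqVneq j (J i).
  by rewrite sample_entry_same // subrr mulr0 eqxx.
have [nz _] := entry_root_signs (expa_gt0 i) (sample_small iN) (hJ i).
by rewrite sample_entry // (negbTE (nz _ _ _)).
Qed.

Lemma sample_sgr_sum i : (i < N)%N -> \sum_(j < n) Num.sg (row_val X i j) = 0.
Proof.
move=> iN; have [_ E] := entry_root_signs (expa_gt0 i) (sample_small iN) (hJ i).
rewrite -[RHS]E.
by apply: eq_bigr => j _; rewrite sample_entry.
Qed.

End Sample.

End StackRows.

(** * Independence of the stacked rows; samples are edge points *)

Section StackEdges.
Variables (R : realType) (k N : nat).
Local Notation n := (4 * k + 1)%N.
Local Notation a := (alpha R k).
Local Notation b := (Defs.col0 R k).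
Local Notation s := (sgn_col R k).
Local Notation L := (@stack_row R k N).

Lemma vec_inord (x : 'cV[R]_N.+2) : x = vec N (fun m => x (inord m) 0).
Proof. by apply/colP => c; rewrite mxE inord_val. Qed.

(** Rows 0 and 1 of the first block share the sign +1 but differ in column 0, so [X 0] vanishes;
    then two rows of opposite sign in block [i] isolate [X i.+1]. *)
Lemma stack_row_separates (x : 'cV[R]_N.+2) : (0 < k)%N -> (forall p, ev (L p) x = 0) -> x = 0.
Proof.
move=> hk; rewrite (vec_inord x); set X := fun m => _; move=> x0.
have E i j : (i <= N)%N -> (j < n)%N ->
    a ^+ i * b j * X 0%N + s j * X i.+1 + (i < N)%:R * X i.+2 = 0.
  move=> iN jn; have iN' : (i < N.+1)%N by [].
  have := x0 (Ordinal iN', Ordinal jn); rewrite ev_stack_row /= => /eqP.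
  by rewrite mulf_eq0 (gt_eqF (expa_gt0 _ _ i)) => /eqP.
have X0 : X 0%N = 0.
  have h0 : (0 < n)%N by lia.
  have h1 : (1 < n)%N by lia.
  have := E 0%N 0%N isT h0; have := E 0%N 1%N isT h1.
  by rewrite !(col0_lo, sgn_lo, expr0) ?mulr0n; [lra|lia..].
have Xi i : (i <= N)%N -> X i.+1 = 0.
  have h0 : (0 < n)%N by lia.
  have h1 : (2 * k + 1 + 0 < n)%N by lia.
  move=> iN; have := E i 0%N iN h0; have := E i (2 * k + 1 + 0)%N iN h1.
  rewrite X0 sgn_hi sgn_lo; last by lia.
  by move: (_%:R * _) => w; rewrite !mulr0; lra.
apply/colP => -[[|c] hc]; rewrite !mxE //=; exact: Xi.
Qed.

Lemma stack_row_neq0 p : L p != 0.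
Proof.
have h1 : (p.1.+1 < N.+2)%N by rewrite ltnS.
apply/eqP => /rowP/(_ (Ordinal h1)); rewrite stack_rowE mxE /=.
rewrite eqxx mul0r add0r mul1r (ltn_eqF (ltnSn _)) addr0 => /eqP.
rewrite mulf_eq0 (gt_eqF (expa_gt0 _ _ _)) /= /sgn_col.
by case: ifP; rewrite ?oppr_eq0 oner_eq0.
Qed.

Lemma sgn_col_neq0 j : s j != 0.
Proof. by rewrite /sgn_col; case: ifP; rewrite ?oppr_eq0 oner_eq0. Qed.

Lemma col0_inj j l : (j < n)%N -> (l < n)%N -> s j = s l -> b j = b l -> j = l.
Proof.
move=> jn ln; move: j jn l ln; apply: rows_ind => [j hj|p hp]; apply: rows_ind => [l hl|q hq].
- by rewrite !col0_lo // => _ /addrI/oppr_inj/eqP; rewrite eqr_nat => /eqP.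
- by rewrite sgn_hi sgn_lo // => ?; exfalso; lra.
- by rewrite sgn_hi sgn_lo // => ?; exfalso; lra.
- by rewrite !col0_hi // => _ /addrI/eqP; rewrite eqr_nat => /eqP ->.
Qed.

(** Rows of opposite sign have an integer and a half-integer in column 0. *)
Lemma col0_neg j l : (j < n)%N -> (l < n)%N -> s j = - s l -> b j != - b l.
Proof.
have D m p : (m < 2 * k + 1)%N -> k%:R - m%:R != - (- k%:R + 2^-1 + p%:R) :> R.
  move=> hm; apply/eqP => h; have : (2 * m)%:R = (2 * p + 1)%:R :> R.
    by rewrite natrD !natrM; lra.
  by move/eqP; rewrite eqr_nat; lia.
move=> jn ln; move: j jn l ln; apply: rows_ind => [j hj|p hp]; apply: rows_ind => [l hl|q hq].
- by rewrite !sgn_lo // => ?; exfalso; lra.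
- by rewrite col0_hi col0_lo // => _; apply: D.
- by rewrite col0_hi col0_lo // => _; rewrite eq_sym eqr_oppLR; apply: D.
- by rewrite !sgn_hi => ?; exfalso; lra.
Qed.

Lemma comb_planar (nu : nat -> nat -> R) (r : 'rV[R]_N.+2) :
  (forall i, (i < N)%N -> r 0 (inord i.+2) + (a ^+ i * \sum_(j < n) nu i j
     + a ^+ i.+1 * \sum_(j < n) s j * nu i.+1 j) = 0) ->
  planar (r + \sum_(p : 'I_N.+1 * 'I_n) nu p.1 p.2 *: L p).
Proof.
move=> H c c1; have [i ci] : exists i, c = i.+2 :> nat.
  by case: c c1 => -[|[|i]] //= *; exists i.
have iN : (i < N)%N by rewrite -2!ltnS -ci.
by rewrite mxE (comb_coord _ nu ci) -[X in r 0 X]inord_val ci H.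
Qed.

Section SampleEdge.
Variables (J : nat -> nat) (r : nat) (X : nat -> R).
Hypotheses (hJ : forall i, (J i < n)%N) (hr : (r <= n)%N) (hX : sample k N J r X).

Let X0 : X 0%N = 1. Proof. by case: hX. Qed.

Lemma sample_ev_eq0 p : (ev (L p) (vec N X) == 0) = (p.1 < N)%N && (p.2 == J p.1 :> nat).
Proof. by rewrite ev_vec_eq0 // (sample_eq0 hJ hr hX) // -ltnS. Qed.

Lemma sum_at_J (v : R) i : \sum_(j < n) (if j == J i :> nat then v else 0) = v.
Proof.
rewrite (bigD1 (Ordinal (hJ i))) //= eqxx big1 ?addr0 // => j /negbTE.
by rewrite -val_eqE /= => ->.
Qed.

Lemma sample_solve (v : 'rV[R]_N.+2) : exists delta : 'I_N.+1 * 'I_n -> R,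
  (forall p, ev (L p) (vec N X) != 0 -> delta p = 0) /\
  planar (v + \sum_p delta p *: L p).
Proof.
(* [F i] solves the equation of coordinate [i.+2] for the coefficient of row [J i]; the start value
   is 0 because no row of the last block vanishes. *)
pose F (i : nat) (y : R) : R := - (a ^- i) * (v 0 (inord i.+2) + a ^+ i.+1 * (s (J i.+1) * y)).
have [f [fN fF]] := downward_rec F N 0.
pose nu (i j : nat) : R := if (i < N)%N && (j == J i) then f i else 0.
exists (fun p : 'I_N.+1 * 'I_n => nu p.1 p.2); split.
  by move=> p; rewrite sample_ev_eq0 /nu => /negbTE ->.
apply: comb_planar => i iN.
have -> : \sum_(j < n) nu i j = f i.
  by rewrite /nu iN /= sum_at_J.
have -> : \sum_(j < n) s j * nu i.+1 j = s (J i.+1) * f i.+1.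
  have [iN1|] := ltnP i.+1 N; last first.
    move=> iN1; have -> : i.+1 = N by lia.
    by rewrite fN mulr0 big1 // => j _; rewrite /nu ltnn mulr0.
  rewrite -[RHS](sum_at_J _ i.+1); apply: eq_bigr => j _.
  by rewrite /nu iN1 /=; case: eqP => [->|]; rewrite ?mulr0.
have u0 : a ^+ i != 0 by rewrite gt_eqF // expa_gt0.
rewrite fF // /F; move: (a ^+ i) (a ^+ i.+1) u0 => u w u0; field.
exact: u0.
Qed.

Lemma sample_mult : exists mu, edge_multiplier L (vec N X) mu.
Proof.
pose m (y : R) (i j : nat) : R := if (i < N)%N && (j == J i) then y else Num.sg (row_val k N X i j).
pose F (i : nat) (y : R) : R := - a * \sum_(j < n) s j * m y i.+1 j.
have [f [fN fF]] := downward_rec F N 0.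
pose nu (i j : nat) : R := m (f i) i j.
have m_le1 y i j : `|y| <= 1 -> `|m y i j| <= 1.
  move=> y1; rewrite /m; case: ifP => // _; rewrite normr_sg.
  by case: (_ != 0); rewrite ?ler01.
(* The sum over the next block has [n] terms of modulus at most 1, and [alpha * n < 1]. *)
have f_lt1 i : (i <= N)%N -> `|f i| < 1.
  move=> iN; rewrite -(subKn iN); elim: (N - i)%N (leq_subr i N) => [_|l IH lN].
    by rewrite subn0 fN normr0 ltr01.
  have := IH (ltnW lN); rewrite -(subnSK lN); set u := (N - l.+1)%N => fu.
  have uN : (u < N)%N by rewrite /u; lia.
  rewrite fF // /F normrM normrN (gtr0_norm (alpha_gt0 _ _)).
  have : `|\sum_(j < n) s j * m (f u.+1) u.+1 j| <= n%:R.
    rewrite (le_trans (ler_norm_sum _ _ _)) //.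
    rewrite -[X in _ <= X%:R]card_ord -sum1_card natr_sum; apply: ler_sum => j _.
    rewrite normrM; have -> : `|s j| = 1 by rewrite /sgn_col; case: ifP; rewrite ?normrN normr1.
    by rewrite mul1r m_le1 // ltW.
  move=> /(ler_wpM2l (ltW (alpha_gt0 R k))) /le_lt_trans; apply.
  by rewrite mulrC natr_alpha ltrBlDr ltrDl alpha_gt0.
exists (fun p : 'I_N.+1 * 'I_n => nu p.1 p.2); split.
- by move=> p; rewrite sample_ev_eq0 sgr_ev_vec // /nu /m => /negbTE ->.
- move=> p /eqP; rewrite sample_ev_eq0 /nu /m => pJ; rewrite pJ f_lt1 //.
  by move: pJ => /andP[/ltnW].
rewrite -[\sum_p _]add0r; apply: comb_planar => i iN.
rewrite mxE add0r.
have -> : \sum_(j < n) nu i j = f i.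
  transitivity (\sum_(j < n) (if j == J i :> nat then f i else 0) +
      \sum_(j < n) Num.sg (row_val k N X i j)); last first.
    by rewrite sum_at_J (sample_sgr_sum hJ hr hX) // addr0.
  rewrite -big_split /=; apply: eq_bigr => j _; rewrite /nu /m iN /=; case: eqP => [->|_]; last by rewrite add0r.
  have /eqP -> : row_val k N X i (J i) == 0 by rewrite (sample_eq0 hJ hr hX) ?iN ?eqxx // ltnW.
  by rewrite sgr0 addr0.
rewrite {1}fF // /F -/(nu _ _) exprSr; set S := \sum_(j < n) _; rewrite -/S; ring.
Qed.

Lemma sample_turn (hd : (2 <= N.+2)%N) : exists y,
  (forall p, ev (L p) (vec N X) = 0 -> ev (L p) y = 0) /\
  0 < det2 (proj2 hd (vec N X)) (proj2 hd y).
Proof.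
(* With coordinate 0 equal to 0, row [J l] vanishes as soon as [Y l.+2 = - s (J l) * Y l.+1];
   starting from [Y 1 = 1] makes the determinant 1. *)
pose Y i := if i is i'.+1 then \prod_(l < i') - s (J l) else 0.
exists (vec N Y); split.
  move=> p /eqP; rewrite sample_ev_eq0 => /andP[pN /eqP pJ].
  rewrite ev_stack_row pN pJ /Y big_ord_recr /= mulr0 add0r mul1r mulrN.
  by rewrite [X in _ * (X - _)]mulrC subrr mulr0.
by rewrite /det2 !mxE /= X0 /Y /= big_ord0 mulr0 subr0 mulr1 ltr01.
Qed.

Lemma sample_edge_point (hd : (2 <= N.+2)%N) : edge_point hd L (vec N X).
Proof. by split; [exact: sample_solve|exact: sample_mult|exact: sample_turn]. Qed.

End SampleEdge.
End StackEdges.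

(** * Counting *)

Section Count.
Variables (R : realType) (k N : nat).
Local Notation n := (4 * k + 1)%N.
Local Notation a := (alpha R k).
Local Notation b := (Defs.col0 R k).
Local Notation s := (sgn_col R k).
Local Notation L := (@stack_row R k N).

(** For different blocks, the sign column of the earlier one is zero in the later one. Within a
    block that column forces [t] to be 1 or -1, and column 0 excludes both. *)
Lemma stack_row_not_multiple p q (t : R) : p != q -> L p != t *: L q.
Proof.
case: p q => i j [i' j'] pq; apply/eqP => E.
have {}E c : L (i, j) 0 c = t * L (i', j') 0 c by rewrite E mxE.
have sE (l m : 'I_N.+1) (u : 'I_n) (h : (m.+1 < N.+2)%N) :
    L (l, u) 0 (Ordinal h) = a ^+ l * ((m == l)%:R * s u + (m == l.+1 :> nat)%:R).
  by rewrite stack_rowE /= mul0r add0r !eqSS.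
have h (m : 'I_N.+1) : (m.+1 < N.+2)%N by rewrite ltnS.
have a0 l : a ^+ l != 0 by rewrite gt_eqF // expa_gt0.
have [ii'|i'i|ii'] := ltngtP i i'.
- have := E (Ordinal (h i)); rewrite !sE eqxx -val_eqE /= !ltn_eqF //; last exact: leqW.
  rewrite mul1r mul0r !addr0 mulr0 mulr0 => /eqP.
  by rewrite mulf_eq0 (negbTE (a0 _)) (negbTE (sgn_col_neq0 _ _ _)).
- have := E (Ordinal (h i')); rewrite !sE eqxx -val_eqE /= !ltn_eqF //; last exact: leqW.
  rewrite mul1r mul0r !addr0 mulr0 => /esym/eqP.
  rewrite mulf_eq0 mulf_eq0 (negbTE (a0 _)) (negbTE (sgn_col_neq0 _ _ _)) !orbF => /eqP t0.
  have /eqP := @stack_row_neq0 R k N (i, j); apply; apply/rowP => c.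
  by rewrite E t0 mul0r mxE.
have {ii'} ii' : i = i' by apply: val_inj.
rewrite -{}ii' in pq E.
have jj' : j != j' :> nat by move: pq; rewrite xpair_eqE eqxx.
have Es : s j = t * s j'.
  have := E (Ordinal (h i)); rewrite !sE eqxx (ltn_eqF (ltnSn _)) !addr0 !mul1r.
  by rewrite mulrCA => /(mulfI (a0 _)).
have Eb : b j = t * b j'.
  have := E ord0; rewrite !stack_rowE /= !mul0r !addr0 !mul1r.
  by rewrite [RHS]mulrCA => /(mulfI (a0 _)); rewrite [RHS]mulrCA => /(mulfI (a0 _)).
have [ss|ss] : s j = s j' \/ s j = - s j'.
  by rewrite /sgn_col; do 2 case: ifP => _; rewrite ?opprK; tauto.
- have t1 : t = 1 by apply: (mulIf (sgn_col_neq0 R k j')); rewrite -Es mul1r.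
  move: jj'; rewrite (@col0_inj R k j j') ?eqxx //.
  by rewrite Eb t1 mul1r.
- have t1 : t = -1 by apply: (mulIf (sgn_col_neq0 R k j')); rewrite -Es mulN1r.
  by have /eqP := @col0_neg R k j j' (ltn_ord _) (ltn_ord _) ss; rewrite Eb t1 mulN1r.
Qed.

(** Supplies a row of the first block, other than [J 0], whose value at a sample depends on [J 0]
    alone. *)
Lemma same_sign_row j : (0 < k)%N -> (j < n)%N ->
  exists l, [/\ (l < n)%N, l != j & s l = s j].
Proof.
move=> hk; move: j; apply: rows_ind => [j hj|p hp].
  exists (if j == 0%N then 1%N else 0%N).
  by case: eqP => j0; split; rewrite ?sgn_lo //; lia.
exists (2 * k + 1 + if p == 0%N then 1%N else 0%N)%N.
by case: eqP => p0; split; rewrite ?sgn_hi //; lia.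
Qed.

Lemma sgr_scale (u : R) (x y : nat) : 0 < u -> x != y ->
  Num.sg (u * (x%:R - y%:R)) = (-1) ^+ (x < y)%N.
Proof.
move=> u0; rewrite sgrM gtr0_sg // mul1r; case: ltngtP => // [xy|yx] _.
  by rewrite ltr0_sg // subr_lt0 ltr_nat.
by rewrite gtr0_sg // subr_gt0 ltr_nat.
Qed.

(** * Recovering the choices behind a sample from its signs *)

Section Pair.
Variables (J J' : nat -> nat) (r r' : nat) (X X' : nat -> R) (e e' : bool).
Hypotheses (hJ : forall i, (J i < n)%N) (hr : (r <= n)%N) (hX : sample k N J r X).
Hypotheses (hJ' : forall i, (J' i < n)%N) (hr' : (r' <= n)%N) (hX' : sample k N J' r' X').
Hypothesis H : forall i j, (i <= N)%N -> (j < n)%N ->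
  (-1) ^+ e * Num.sg (row_val k N X i j) = (-1) ^+ e' * Num.sg (row_val k N X' i j).

Lemma sample_inj_J i : (i < N)%N -> J i = J' i.
Proof.
move=> iN; have iN' := ltnW iN.
have /eqP E : row_val k N X i (J i) == 0 by rewrite (sample_eq0 hJ hr hX) // iN eqxx.
have := H iN' (hJ i); rewrite E sgr0 mulr0 => /esym/eqP.
rewrite mulf_eq0 signr_eq0 sgr_eq0 /= (sample_eq0 hJ' hr' hX') // iN.
by move/eqP.
Qed.

Lemma sample_inj_sign : (0 < k)%N -> (0 < N)%N || (r < n)%N && (r' < n)%N -> e = e'.
Proof.
move=> hk; suff key i j : (i <= N)%N -> (j < n)%N -> row_val k N X i j != 0 ->
    Num.sg (row_val k N X i j) = Num.sg (row_val k N X' i j) -> e = e'.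
  case/orP=> [N0|/andP[rn rn']].
    have [l [ln lJ sl]] := same_sign_row hk (hJ 0%N).
    apply: (key 0%N l) => //; first by rewrite (sample_eq0 hJ hr hX) // N0.
    by rewrite (sample_entry_same hX) // (sample_entry_same hX') // -sample_inj_J.
  (* Row [2 * k] of the last block has the largest threshold of sign +1, [8 * k + 1]; it exceeds
     [2 * r] whenever [r < n], so the row is negative at both samples. *)
  have kn : (2 * k < n)%N by lia.
  have kk : (2 * k < 2 * k + 1)%N by lia.
  apply: (key N (2 * k)%N) => //; first by rewrite (sample_eq0 hJ hr hX) // ltnn.
  rewrite (sample_last_lo hX) // (sample_last_lo hX') //.
  rewrite !sgr_scale ?divr_gt0 ?expa_gt0 //; [congr (_ ^+ _); lia|lia..].
move=> iN jn v0 vv'; have := H iN jn; rewrite -vv' => /mulIf.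
by rewrite sgr_eq0 => /(_ v0) /signr_inj.
Qed.

End Pair.

(** For [r < r'] a threshold separates [2 * r] from [2 * r']: it is [4 * m + 1] if [r = 2 * m], and
    [4 * m + 3] if [r = 2 * m + 1]. *)
Lemma sample_inj_last J J' r r' (X X' : nat -> R) :
  (r <= n)%N -> sample k N J r X -> (r' <= n)%N -> sample k N J' r' X' ->
  (forall j, (j < n)%N -> Num.sg (row_val k N X N j) = Num.sg (row_val k N X' N j)) ->
  r = r' :> nat.
Proof.
wlog rr' : J J' r r' X X' / (r < r')%N.
  move=> W hr hX hr' hX' H; have [rr'|rr'|//] := ltngtP r r'; first exact: (W J J' r r' X X').
  by apply/esym; apply: (W J' J r' r X' X) => // j jn; rewrite H.
move=> hr hX hr' hX' H; have u0 : 0 < a ^+ N / 4 by rewrite divr_gt0 ?expa_gt0.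
have [m [rm|rm]] : exists m, r = (2 * m)%N \/ r = (2 * m + 1)%N.
  by exists (r %/ 2)%N; lia.
- have mk : (m < 2 * k + 1)%N by lia.
  have mn : (m < n)%N by lia.
  have := H m mn; rewrite (sample_last_lo hX) // (sample_last_lo hX') //.
  by rewrite !sgr_scale //; [move/signr_inj; lia|lia..].
- have mn : (2 * k + 1 + m < n)%N by lia.
  have := H _ mn; rewrite (sample_last_hi hX) (sample_last_hi hX').
  by rewrite !sgr_scale //; [move/signr_inj; lia|lia..].
Qed.

Definition choice_row (f : {ffun 'I_N -> 'I_n}) (i : nat) : nat :=
  oapp (fun l : 'I_N => val (f l)) 0%N (insub i).

Lemma choice_row_lt f i : (choice_row f i < n)%N.
Proof. by rewrite /choice_row; case: insubP => [l _ _|_] /=; [exact: ltn_ord|lia]. Qed.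

Lemma choice_row_inj f g :
  (forall i, (i < N)%N -> choice_row f i = choice_row g i) -> f = g.
Proof.
move=> fg; apply/ffunP => l; apply: val_inj.
by have := fg l (ltn_ord l); rewrite /choice_row valK.
Qed.

(* For [N = 0] the levels [0] with one sign and [n] with the other give the same
   edge, so the last level has to be left out. *)
Lemma card_vertices_proj (hd : (2 <= N.+2)%N) q : (0 < k)%N -> (q <= n.+1)%N ->
  (0 < N)%N || (q <= n)%N ->
  `I_(2 * n ^ N * q) #<=
    vertices (proj2 hd @` [set x | \sum_p `|ev (L p) x| <= 1]).
Proof.
move=> hk qn Nq.
pose I := (bool * {ffun 'I_N -> 'I_n} * 'I_q)%type.
have -> : (2 * n ^ N * q)%N = #|{: I}|.
  by rewrite !card_prod card_bool card_ffun !card_ord.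
have [X hX] := choice (fun t : I => @exists_sample R k N (choice_row t.1.2) t.2).
have qle (t : I) : (t.2 <= n)%N by rewrite -ltnS (leq_trans (ltn_ord _)).
have X0 t : X t 0%N = 1 by have [] := hX t.
apply: (@card_edge_points R N hd _ L _ I (fun t => (-1) ^+ t.1.1 *: vec N (X t))).
- by move=> x; apply: stack_row_separates.
- move=> t; have E := sample_edge_point (choice_row_lt _) (qle t) (hX t) hd.
  by case: t.1.1; rewrite ?scaleN1r ?scale1r //; apply: edge_pointN.
move=> [[e f] r] [[e' f'] r']; set t := (_, _, _); set t' := (_, _, r') => H.
have {}H i j : (i <= N)%N -> (j < n)%N ->
    (-1) ^+ e * Num.sg (row_val k N (X t) i j) =
    (-1) ^+ e' * Num.sg (row_val k N (X t') i j).
  move=> iN jn; have iN' : (i < N.+1)%N by [].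
  have := H (Ordinal iN', Ordinal jn).
  by rewrite !evZr !sgrM !sgr_ev_vec //= !sgrX sgrN1.
have ee' : e = e'.
  apply: (sample_inj_sign (choice_row_lt f) (qle t) (hX t) (choice_row_lt f') (qle t') (hX t') H hk).
  by case/orP: Nq => [->//|qn']; rewrite !(leq_trans (ltn_ord _) qn') orbT.
rewrite -{}ee' in t' H *.
have ff' : f = f'.
  apply: choice_row_inj => i iN.
  exact: (sample_inj_J (choice_row_lt f) (qle t) (hX t) (choice_row_lt f') (qle t') (hX t') H).
congr (_, _, _) => //; apply: val_inj.
apply: (sample_inj_last (qle t) (hX t) (qle t') (hX t')) => j jn.
by have /mulfI := H N j (leqnn N) jn; apply; rewrite signr_eq0.
Qed.

End Count.

Lemma stack_dual_zonotope (R : realType) k N : dual_zonotope (stackA R k N.+2) =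
  [set x | \sum_p `|ev (@stack_row R k N p) x| <= 1].
Proof.
have E (x : 'cV_N.+2) : \sum_j `|(row j (stackA R k N.+2) *m x) 0 0| =
    \sum_p `|ev (@stack_row R k N p) x|.
  rewrite (reindex (@stack_index k N)); last exact: onW_bij (stack_index_bij k N).
  by apply: eq_bigr => p _; rewrite row_stackA.
by apply/seteqP; split=> x; rewrite /dual_zonotope /= E.
Qed.

Lemma stack_is_dual_zonotope (R : realType) k N : (0 < k)%N ->
  is_dual_zonotope (N.+1 * (4 * k + 1)) (dual_zonotope (stackA R k N.+2)).
Proof.
move=> hk; have full : row_full (stackA R k N.+2).
  apply: row_fullP0 => x Ax; apply: (stack_row_separates hk) => p.
  by rewrite -row_stackA /ev -row_mul Ax !mxE.
split; first exact: dual_zonotope_polytope.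
have [g _ gK] := stack_index_bij k N.
exists (stackA R k N.+2); split=> // [j|j l jl t].
  by rewrite -(gK j) row_stackA; apply: stack_row_neq0.
rewrite -(gK j) -(gK l) !row_stackA; apply: stack_row_not_multiple.
by apply: contraNneq jl => gjl; rewrite -(gK j) gjl gK.
Qed.

(* In the plane (d = 2) the polygon Z* has n zones, hence only 2n vertices, and
   the bound 2n^(d-1) + 2n^(d-2) = 2n + 2 fails. It is claimed for d >= 3; for
   d = 2 the attained number 2n is claimed instead. *)
Theorem theorem4p4 (R : realType) (k d : nat) (hk : (0 < k)%N) (hd : (2 <= d)%N) :
  let n := (4 * k + 1)%N in
  let Z := dual_zonotope (stackA R k d) in
  is_dual_zonotope (d.-1 * n) Z /\
  ((2 < d)%N ->
     `I_(2 * n ^ d.-1 + 2 * n ^ d.-2) #<= vertices (proj2 hd @` Z)) /\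
  (d = 2%N -> `I_(2 * n) #<= vertices (proj2 hd @` Z)).
Proof.
case: d hd => [//|[//|N]] hd n Z /=; split; first exact: stack_is_dual_zonotope.
rewrite /Z stack_dual_zonotope; split=> [N0|[N0]].
  (* All [n + 1] levels of the last coordinate are used here; for [d = 2] only [n] of them are. *)
  have -> : (2 * n ^ N.+1 + 2 * n ^ N = 2 * n ^ N * n.+1)%N by rewrite expnSr; lia.
  by apply: card_vertices_proj => //; rewrite -(ltn_add2r 2) !addn2 N0.
have -> : (2 * n = 2 * n ^ N * n)%N by rewrite N0 expn0 muln1.
by apply: card_vertices_proj; rewrite ?leqnSn ?leqnn ?orbT.
Qed.
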